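(* Suppose $\mathcal{B}$ is a Boolean algebra that is embeddable into the Medvedev lattice as a lattice, i.e. there is an injective map from $\mathcal{B}$ into the Medvedev degrees preserving binary meets and joins. Then $\mathcal{B}$ is countable.
   Context: A mass problem is a subset of $\omega^\omega$. $\mathcal{A}\leq_M\mathcal{B}$ means there is a partial computable functional $\Psi$ defined on all of $\mathcal{B}$ with $\Psi(\mathcal{B})\subseteq\mathcal{A}$; the Medvedev lattice consists of the $\equiv_M$-classes of mass problems, with join induced by $\mathcal{A}+\mathcal{B}=\{f\oplus g:f\in\mathcal{A},g\in\mathcal{B}\}$ (where $(f\oplus g)(2x)=f(x)$, $(f\oplus g)(2x+1)=g(x)$) and meet induced by $\mathcal{A}\times\mathcal{B}=\{0\,\widehat{\ }\,f:f\in\mathcal{A}\}\cup\{1\,\widehat{\ }\,g:g\in\mathcal{B}\}$. *)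

(* Defs.v *)
From HB Require Import structures.
From mathcomp Require Import all_boot all_order.
From mathcomp Require Import boolp classical_sets cardinality.

Set Implicit Arguments.
Unset Strict Implicit.
Unset Printing Implicit Defensive.

Import Order.TTheory.
Local Open Scope quotient_scope.
Local Open Scope classical_set_scope.

Inductive code : Type :=
| Zero
| Succ
| Proj of nat
| Oracle
| Comp of code & seq code
| PrimRec of code & code
| Mu of code.

Fixpoint all2P (S T : Type) (R : S -> T -> Prop) (s : seq S) (t : seq T) : Prop :=
  match s, t with
  | [::], [::] => True
  | x :: s', y :: t' => R x y /\ all2P R s' t'
  | _, _ => False
  end.

(* Kleene's mu-recursive functions relative to an oracle.
   [eval f c xs y]: with oracle f, code c halts on the arguments xs with value
   y. Codes carry no arity: missing arguments are read as 0 and superfluous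
   ones are ignored. In the primitive recursion case, the recursion variable is
   the first argument and r lists the successive values; composition is
   strict, and minimization searches on the first argument, requiring the
   earlier values to be defined and nonzero. *)
Fixpoint eval (f : nat -> nat) (c : code) (xs : seq nat) (y : nat) : Prop :=
  match c with
  | Zero => y = 0
  | Succ => y = (head 0 xs).+1
  | Proj i => y = nth 0 xs i
  | Oracle => y = f (head 0 xs)
  | Comp g hs =>
      exists ys, all2P (fun h z => eval f h xs z) hs ys /\ eval f g ys y
  | PrimRec b s =>
      exists r : nat -> nat,
        [/\ eval f b (behead xs) (r 0),
            forall i, i < head 0 xs ->
              eval f s [:: i, r i & behead xs] (r i.+1)
          & r (head 0 xs) = y]
  | Mu g =>
      eval f g (y :: xs) 0 /\
      forall i, i < y -> exists z, eval f g (i :: xs) z.+1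
  end.

Definition baire : Type := nat -> nat.

Definition mass_problem : Type := set baire.

(* A partial functional on Baire space is given by its graph; the one computed
   by c is defined at f exactly when c with oracle f computes a total unary
   function. *)
Definition partial_computable (Psi : baire -> baire -> Prop) : Prop :=
  exists c : code, forall f g, Psi f g <-> forall n, eval f c [:: n] (g n).

Definition medvedev_le (A B : mass_problem) : Prop :=
  exists Psi : baire -> baire -> Prop,
    [/\ partial_computable Psi,
        forall f, B f -> exists g, Psi f g
      & forall f g, B f -> Psi f g -> A g].

Definition medvedev_equiv (A B : mass_problem) : Prop :=
  medvedev_le A B /\ medvedev_le B A.

Definition interleave (f g : baire) : baire :=
  fun n => if odd n then g n./2 else f n./2.

Definition prepend (i : nat) (f : baire) : baire :=
  fun n => if n is m.+1 then f m else i.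

Definition mass_join (A B : mass_problem) : mass_problem :=
  [set h | exists f g, [/\ A f, B g & h = interleave f g]].

Definition mass_meet (A B : mass_problem) : mass_problem :=
  [set h | (exists2 f, A f & h = prepend 0 f) \/
           (exists2 g, B g & h = prepend 1 g)].

Definition code_nested_ind (P : code -> Prop)
    (PZero : P Zero) (PSucc : P Succ) (PProj : forall i, P (Proj i))
    (POracle : P Oracle)
    (PComp : forall g hs,
      P g -> foldr (fun h Q => P h /\ Q) True hs -> P (Comp g hs))
    (PPrimRec : forall b s, P b -> P s -> P (PrimRec b s))
    (PMu : forall g, P g -> P (Mu g)) : forall c, P c :=
  fix code_nested_ind (c : code) : P c :=
  match c with
  | Zero => PZero
  | Succ => PSucc
  | Proj i => PProj i
  | Oracle => POracle
  | Comp g hs =>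
      PComp _ _ (code_nested_ind g)
        ((fix all_ind hs : foldr (fun h Q => P h /\ Q) True hs :=
           match hs with
           | [::] => I
           | h :: hs' => conj (code_nested_ind h) (all_ind hs')
           end) hs)
  | PrimRec b s => PPrimRec _ _ (code_nested_ind b) (code_nested_ind s)
  | Mu g => PMu _ (code_nested_ind g)
  end.

Lemma eval_fun (f : baire) (c : code) (xs : seq nat) (y z : nat) :
  eval f c xs y -> eval f c xs z -> y = z.
Proof.
elim/code_nested_ind: c xs y z
  => [||i||g hs IHg IHhs|b s IHb IHs|g IHg] xs y z /=; try by move=> -> ->.
- move=> [ys [hys gy]] [zs [hzs gz]].
  have eq_yz : ys = zs.
    elim: hs IHhs ys zs hys hzs {gy gz}
      => [|h hs IH] /= IHhs [|y1 ys] [|z1 zs] //.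
    by case: IHhs => Ih /IH{}IH [/Ih{}Ih /IH{}IH] [/Ih -> /IH ->].
  by rewrite -eq_yz in gz; apply: IHg gy gz.
- move=> [r [r0 rS <-]] [t [t0 tS <-]].
  elim: (head 0 xs) rS tS => [|n IHn] rS tS; first exact: IHb r0 t0.
  have eq_n : r n = t n.
    by apply: IHn => i lt_in; [apply: rS | apply: tS]; apply: ltnW.
  by have := tS n (leqnn _); rewrite -eq_n; apply: IHs (rS n (leqnn _)).
- move=> [gy lt_y] [gz lt_z]; case: (ltngtP y z) => //.
    by move=> /lt_z[w gw]; have := IHg _ _ _ gy gw.
  by move=> /lt_y[w gw]; have := IHg _ _ _ gz gw.
Qed.

Fixpoint oracle_subst (e c : code) : code :=
  match c with
  | Oracle => Comp e [:: Proj 0]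
  | Comp g hs => Comp (oracle_subst e g) [seq oracle_subst e h | h <- hs]
  | PrimRec b s => PrimRec (oracle_subst e b) (oracle_subst e s)
  | Mu g => Mu (oracle_subst e g)
  | c => c
  end.

Lemma eval_oracle_subst (f g : baire) (e : code) :
  (forall n, eval f e [:: n] (g n)) ->
  forall (c : code) (xs : seq nat) (y : nat),
    eval f (oracle_subst e c) xs y <-> eval g c xs y.
Proof.
move=> efg; elim/code_nested_ind
  => [||i||c hs IHc IHhs|b s IHb IHs|c IHc] xs y //=.
- rewrite -nth0; split=> [[ys []]|->]; last by exists [:: nth 0 xs 0].
  by case: ys => [|y1 [|? ?]] //= -[] -> // _ /eval_fun; apply.
- have E ys : all2P (fun h z => eval f h xs z) (map (oracle_subst e) hs) ys <->
              all2P (fun h z => eval g h xs z) hs ys.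
    elim: hs IHhs ys => [|h hs IH] /= IHhs [|y1 ys] //.
    by case: IHhs => Ih /IH{}IH; rewrite Ih IH.
  by split=> -[ys [/E hys /IHc cy]]; exists ys.
- split=> -[r [r0 rS rE]]; exists r; split=> //; try exact/IHb.
    by move=> i /rS/IHs.
  by move=> i /rS ri; apply/IHs.
- split=> -[/IHc cy lt_y]; split=> // i /lt_y[z].
    by move/IHc; exists z.
  by move=> cz; exists z; apply/IHc.
Qed.

Lemma medvedev_leP (A B : mass_problem) :
  medvedev_le A B <->
  exists c, forall f, B f ->
    exists2 g, A g & forall n, eval f c [:: n] (g n).
Proof.
split=> [[Psi [[c cE] Psi_def Psi_sub]]|[c cP]].
  exists c => f Bf; have [g Psi_g] := Psi_def f Bf.
  by exists g; [apply: Psi_sub Psi_g | apply/cE].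
exists (fun f g => forall n, eval f c [:: n] (g n)); split=> [|f /cP[g _]|].
- by exists c.
- by exists g.
- move=> f g /cP[h Ah ch] cg; suff -> : g = h by [].
  by apply/funext => n; apply: eval_fun (cg n) (ch n).
Qed.

Lemma medvedev_le_refl (A : mass_problem) : medvedev_le A A.
Proof. by apply/medvedev_leP; exists Oracle => f Af; exists f. Qed.

Lemma medvedev_le_trans (B A C : mass_problem) :
  medvedev_le A B -> medvedev_le B C -> medvedev_le A C.
Proof.
move=> /medvedev_leP[c cP] /medvedev_leP[e eP]; apply/medvedev_leP.
exists (oracle_subst e c) => f /eP[g /cP[h Ah ch] eg].
by exists h => // n; apply/(eval_oracle_subst eg).
Qed.

Definition code_cond : code := PrimRec (Proj 0) (Proj 3).
Definition code_isz : code := PrimRec (Comp Succ [:: Zero]) Zero.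
Definition code_odd : code := PrimRec Zero (Comp code_isz [:: Proj 1]).
Definition code_half : code :=
  PrimRec Zero
    (Comp code_cond
       [:: Comp code_odd [:: Proj 0]; Proj 1; Comp Succ [:: Proj 1]]).
Definition code_double : code :=
  PrimRec Zero (Comp Succ [:: Comp Succ [:: Proj 1]]).
Definition code_pred : code := PrimRec Zero (Proj 0).

Lemma eval_cond (f : baire) (n x y : nat) :
  eval f code_cond [:: n; x; y] (if n == 0 then x else y).
Proof. by exists (fun i => if i == 0 then x else y); split. Qed.

Lemma eval_isz (f : baire) (n : nat) : eval f code_isz [:: n] (n == 0).
Proof.
by exists (fun i => nat_of_bool (i == 0)); split=> //=; exists [:: 0].
Qed.

Lemma eval_odd (f : baire) (n : nat) : eval f code_odd [:: n] (odd n).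
Proof.
exists (fun i => nat_of_bool (odd i)); split=> // i _.
exists [:: nat_of_bool (odd i)]; split=> //.
by have := eval_isz f (odd i); rewrite eqb0.
Qed.

Lemma eval_half (f : baire) (n : nat) : eval f code_half [:: n] n./2.
Proof.
exists half; split=> // i _.
exists [:: nat_of_bool (odd i); i./2; i./2.+1]; split.
  split; first by exists [:: i]; split=> //; apply: eval_odd.
  by split=> //; split=> //; exists [:: i./2].
suff -> : i.+1./2 = if nat_of_bool (odd i) == 0 then i./2 else i./2.+1.
  exact: eval_cond.
by rewrite -[i.+1./2]/(uphalf i) uphalf_half; case: odd.
Qed.

Lemma eval_double (f : baire) (n : nat) : eval f code_double [:: n] n.*2.
Proof.
exists double; split=> // i _; exists [:: i.*2.+1]; split=> //.
by split=> //; exists [:: i.*2].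
Qed.

Lemma eval_pred (f : baire) (n : nat) : eval f code_pred [:: n] n.-1.
Proof. by exists predn. Qed.

Lemma interleave_double (f g : baire) (n : nat) : interleave f g n.*2 = f n.
Proof. by rewrite /interleave odd_double doubleK. Qed.

Lemma interleave_doubleS (f g : baire) (n : nat) :
  interleave f g n.*2.+1 = g n.
Proof. by rewrite /interleave /= odd_double uphalf_double. Qed.

Lemma mass_join_ubl (A B : mass_problem) : medvedev_le A (mass_join A B).
Proof.
apply/medvedev_leP; exists (Comp Oracle [:: code_double]).
move=> _ [f [g [Af _ ->]]]; exists f => // n; exists [:: n.*2].
by rewrite /= interleave_double; split=> //; split=> //; apply: eval_double.
Qed.

Lemma mass_join_ubr (A B : mass_problem) : medvedev_le B (mass_join A B).
Proof.
apply/medvedev_leP; exists (Comp Oracle [:: Comp Succ [:: code_double]]).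
move=> _ [f [g [_ Bg ->]]]; exists g => // n; exists [:: n.*2.+1].
rewrite /= interleave_doubleS; split=> //; split=> //; exists [:: n.*2].
by split=> //; split=> //; apply: eval_double.
Qed.

Lemma mass_join_lub (A B C : mass_problem) :
  medvedev_le A C -> medvedev_le B C -> medvedev_le (mass_join A B) C.
Proof.
move=> /medvedev_leP[a aP] /medvedev_leP[b bP]; apply/medvedev_leP.
exists (Comp code_cond
          [:: code_odd; Comp a [:: code_half]; Comp b [:: code_half]]) => h Ch.
have [f Af af] := aP h Ch; have [g Bg bg] := bP h Ch.
exists (interleave f g); first by exists f, g.
move=> n; exists [:: nat_of_bool (odd n); f n./2; g n./2]; split.
  split; first exact: eval_odd.
  by do 2!(split; first by exists [:: n./2]; split=> //; split=> //;
           apply: eval_half).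
suff -> : interleave f g n = if nat_of_bool (odd n) == 0 then f n./2 else g n./2.
  exact: eval_cond.
by rewrite /interleave; case: odd.
Qed.

Definition code_prepend (i : code) : code :=
  Comp code_cond [:: Proj 0; i; Comp Oracle [:: code_pred]].

Lemma eval_prepend (f : baire) (c : code) (i n : nat) :
  (forall xs, eval f c xs i) -> eval f (code_prepend c) [:: n] (prepend i f n).
Proof.
move=> ci; exists [:: n; i; f n.-1]; split.
  do 2!split=> //; split=> //; exists [:: n.-1]; split=> //.
  by split=> //; apply: eval_pred.
by have := eval_cond f n i (f n.-1); case: n.
Qed.

Lemma mass_meet_lbl (A B : mass_problem) : medvedev_le (mass_meet A B) A.
Proof.
apply/medvedev_leP; exists (code_prepend Zero) => f Af.
by exists (prepend 0 f) => [|n]; [left; exists f | apply: eval_prepend].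
Qed.

Lemma mass_meet_lbr (A B : mass_problem) : medvedev_le (mass_meet A B) B.
Proof.
apply/medvedev_leP; exists (code_prepend (Comp Succ [:: Zero])) => f Bf.
exists (prepend 1 f) => [|n]; first by right; exists f.
by apply: eval_prepend => xs; exists [:: 0].
Qed.

(* Strict composition would evaluate both branches; a primitive recursion
   evaluates its step code only when the guard is nonzero. *)
Definition code_guard (i c : code) : code :=
  Comp (PrimRec Zero (Comp c [:: Proj 2])) [:: i; Proj 0].

Lemma eval_guard0 (f : baire) (i c : code) (n : nat) :
  eval f i [:: n] 0 -> eval f (code_guard i c) [:: n] 0.
Proof.
by move=> i0; exists [:: 0; n]; split=> //; exists (fun=> 0); split.
Qed.

Lemma eval_guard1 (f : baire) (i c : code) (n y : nat) :
  eval f i [:: n] 1 -> eval f c [:: n] y -> eval f (code_guard i c) [:: n] y.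
Proof.
move=> i1 cy; exists [:: 1; n]; split=> //.
exists (fun j => if j == 0 then 0 else y); split=> // -[|//] _.
by exists [:: n].
Qed.

Lemma mass_meet_glb (A B C : mass_problem) :
  medvedev_le C A -> medvedev_le C B -> medvedev_le C (mass_meet A B).
Proof.
move=> /medvedev_leP[a aP] /medvedev_leP[b bP]; apply/medvedev_leP.
pose hd := Comp Oracle [:: Zero]; pose tl := Comp Oracle [:: Succ].
pose a' := oracle_subst tl a; pose b' := oracle_subst tl b.
pose nhd := Comp code_isz [:: hd].
exists (Comp code_cond [:: hd; code_guard nhd a'; code_guard hd b']).
have hdE h xs : eval h hd xs (h 0) by exists [:: 0].
have nhdE h xs : eval h nhd xs (h 0 == 0).
  by exists [:: h 0]; split; [split=> //; apply: hdE | apply: eval_isz].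
have tlE i h n : eval (prepend i h) tl [:: n] (h n) by exists [:: n.+1].
move=> _ [[f /aP[h Ch ah] ->]|[g /bP[h Ch bh] ->]]; exists h => // n.
  exists [:: 0; h n; 0]; split; last exact: (eval_cond _ 0).
  split; first exact: (hdE (prepend 0 f)).
  split; last by split=> //; apply/eval_guard0/(hdE (prepend 0 f)).
  apply: eval_guard1; first exact: (nhdE (prepend 0 f)).
  exact/(eval_oracle_subst (tlE 0 f)).
exists [:: 1; 0; h n]; split; last exact: (eval_cond _ 1).
split; first exact: (hdE (prepend 1 g)).
split; first exact/eval_guard0/(nhdE (prepend 1 g)).
split=> //; apply: eval_guard1; first exact: (hdE (prepend 1 g)).
exact/(eval_oracle_subst (tlE 1 g)).
Qed.

Definition medvedev_eqb (A B : mass_problem) : bool := `[< medvedev_equiv A B >].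

Fact medvedev_eqb_refl : reflexive medvedev_eqb.
Proof. by move=> A; apply/asboolP; split; apply: medvedev_le_refl. Qed.

Fact medvedev_eqb_sym : symmetric medvedev_eqb.
Proof. by move=> A B; apply: asbool_equiv_eq; split=> -[]. Qed.

Fact medvedev_eqb_trans : transitive medvedev_eqb.
Proof.
move=> B A C /asboolP[AB BA] /asboolP[BC CB]; apply/asboolP.
by split; apply: (@medvedev_le_trans B).
Qed.

Canonical medvedev_equiv_rel :=
  EquivRel medvedev_eqb
    medvedev_eqb_refl medvedev_eqb_sym medvedev_eqb_trans.

Definition medvedev : Type := {eq_quot medvedev_equiv_rel}.

HB.instance Definition _ := Choice.on medvedev.

Definition medvedev_deg (A : mass_problem) : medvedev :=
  \pi_({eq_quot medvedev_equiv_rel}) A.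

Definition medvedev_repr (a : medvedev) : mass_problem :=
  repr (a : {eq_quot medvedev_equiv_rel}).

Lemma medvedev_reprK : cancel medvedev_repr medvedev_deg.
Proof. by move=> a; apply: reprK. Qed.

Lemma medvedev_degP (A B : mass_problem) :
  medvedev_deg A = medvedev_deg B <-> medvedev_equiv A B.
Proof.
split=> [/eqP|AB]; first by rewrite eqmodE => /asboolP.
by apply/eqP; rewrite eqmodE; apply/asboolP.
Qed.

Lemma medvedev_repr_deg (A : mass_problem) :
  medvedev_equiv (medvedev_repr (medvedev_deg A)) A.
Proof. by apply/medvedev_degP; rewrite medvedev_reprK. Qed.

Fact medvedev_display : Order.disp_t.
Proof. exact: (Order.Disp tt tt). Qed.

Definition deg_le (a b : medvedev) : bool :=
  `[< medvedev_le (medvedev_repr a) (medvedev_repr b) >].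

Definition deg_meet (a b : medvedev) : medvedev :=
  medvedev_deg (mass_meet (medvedev_repr a) (medvedev_repr b)).

Definition deg_join (a b : medvedev) : medvedev :=
  medvedev_deg (mass_join (medvedev_repr a) (medvedev_repr b)).

Fact deg_le_refl : reflexive deg_le.
Proof. by move=> a; apply/asboolP/medvedev_le_refl. Qed.

Fact deg_le_anti : antisymmetric deg_le.
Proof.
move=> a b /andP[/asboolP ab /asboolP ba].
by rewrite -[a]medvedev_reprK -[b]medvedev_reprK; apply/medvedev_degP.
Qed.

Fact deg_le_trans : transitive deg_le.
Proof.
by move=> b a c /asboolP ab /asboolP bc; apply/asboolP/(medvedev_le_trans ab bc).
Qed.

HB.instance Definition _ :=
  Order.Le_isPOrder.Build medvedev_display medvedev
    deg_le_refl deg_le_anti deg_le_trans.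

Lemma medvedev_degE (A B : mass_problem) :
  (medvedev_deg A <= medvedev_deg B)%O = `[< medvedev_le A B >].
Proof.
have [rA Ar] := medvedev_repr_deg A; have [rB Br] := medvedev_repr_deg B.
apply: asbool_equiv_eq; split=> AB.
  exact: medvedev_le_trans Ar (medvedev_le_trans AB rB).
exact: medvedev_le_trans rA (medvedev_le_trans AB Br).
Qed.

Fact deg_lexI (a b c : medvedev) :
  (a <= deg_meet b c)%O = (a <= b)%O && (a <= c)%O.
Proof.
rewrite -{1}[a]medvedev_reprK medvedev_degE.
apply/asboolP/andP => [abc|[/asboolP ab /asboolP ac]].
  split; apply/asboolP; apply: medvedev_le_trans abc _.
    exact: mass_meet_lbl.
  exact: mass_meet_lbr.
exact: mass_meet_glb.
Qed.

Fact deg_leUx (a b c : medvedev) :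
  (deg_join a b <= c)%O = (a <= c)%O && (b <= c)%O.
Proof.
rewrite -{1}[c]medvedev_reprK medvedev_degE.
apply/asboolP/andP => [abc|[/asboolP ac /asboolP bc]].
  split; apply/asboolP; apply: (medvedev_le_trans _ abc).
    exact: mass_join_ubl.
  exact: mass_join_ubr.
exact: mass_join_lub.
Qed.

HB.instance Definition _ :=
  Order.POrder_isMeetSemilattice.Build medvedev_display medvedev deg_lexI.

HB.instance Definition _ :=
  Order.POrder_isJoinSemilattice.Build medvedev_display medvedev deg_leUx.

Lemma medvedev_deg_meet (A B : mass_problem) :
  medvedev_deg (mass_meet A B) = (medvedev_deg A `&` medvedev_deg B)%O.
Proof.
have [rA Ar] := medvedev_repr_deg A; have [rB Br] := medvedev_repr_deg B.
apply/medvedev_degP; split; apply: mass_meet_glb.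
- exact: medvedev_le_trans (mass_meet_lbl _ _) Ar.
- exact: medvedev_le_trans (mass_meet_lbr _ _) Br.
- exact: medvedev_le_trans (mass_meet_lbl _ _) rA.
- exact: medvedev_le_trans (mass_meet_lbr _ _) rB.
Qed.

Lemma medvedev_deg_join (A B : mass_problem) :
  medvedev_deg (mass_join A B) = (medvedev_deg A `|` medvedev_deg B)%O.
Proof.
have [rA Ar] := medvedev_repr_deg A; have [rB Br] := medvedev_repr_deg B.
apply/medvedev_degP; split; apply: mass_join_lub.
- exact: medvedev_le_trans Ar (mass_join_ubl _ _).
- exact: medvedev_le_trans Br (mass_join_ubr _ _).
- exact: medvedev_le_trans rA (mass_join_ubl _ _).
- exact: medvedev_le_trans rB (mass_join_ubr _ _).
Qed.

(* Main.v *)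
Require Import Defs.
From mathcomp Require Import all_boot all_order.
From mathcomp Require Import boolp classical_sets cardinality.

Import Order.Theory.

Local Open Scope classical_set_scope.

(** Let [Z] represent the image of the bottom element.  Since [b] and its
    complement meet in the bottom, a single code [e] maps [Z] into the
    disjoint sum of the problems at [b] and [~` b].  If [e] also works for [c],
    then an output of [e] tagged 0 solves the problem at [b] and an output
    tagged 1 solves the one at [~` c]; so [e] witnesses that [b `&` ~` c] lies
    below the bottom, i.e. [b <= c].  By symmetry [e] determines [b], and there
    are only countably many codes. *)

(** [GenTree.tree nat] is a countable type, so an embedding into it lets codes be numbered by
    [pickle]. *)
Fixpoint tree_of_code (c : code) : GenTree.tree nat :=
  match c with
  | Zero => GenTree.Node 0 [::]
  | Succ => GenTree.Node 1 [::]
  | Proj i => GenTree.Leaf i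
  | Oracle => GenTree.Node 2 [::]
  | Comp g hs => GenTree.Node 3 (tree_of_code g :: map tree_of_code hs)
  | PrimRec b s => GenTree.Node 4 [:: tree_of_code b; tree_of_code s]
  | Mu g => GenTree.Node 5 [:: tree_of_code g]
  end.

Fixpoint code_of_tree (t : GenTree.tree nat) : code :=
  match t with
  | GenTree.Leaf i => Proj i
  | GenTree.Node 1 _ => Succ
  | GenTree.Node 2 _ => Oracle
  | GenTree.Node 3 (g :: hs) => Comp (code_of_tree g) (map code_of_tree hs)
  | GenTree.Node 4 [:: b; s] => PrimRec (code_of_tree b) (code_of_tree s)
  | GenTree.Node 5 [:: g] => Mu (code_of_tree g)
  | _ => Zero
  end.

Lemma tree_of_codeK : cancel tree_of_code code_of_tree.
Proof.
elim/code_nested_ind => [||i||g hs IHg IHhs|b s IHb IHs|g IHg] //=.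
- rewrite IHg; congr Comp.
  by elim: hs IHhs => //= h hs IH [-> /IH ->].
- by rewrite IHb IHs.
- by rewrite IHg.
Qed.

Definition reduces (e : code) (A Z : mass_problem) : Prop :=
  forall f, Z f -> exists2 g, A g & forall n, eval f e [:: n] (g n).

(** Evaluation is deterministic, so each output of [e] lies in both sums at once. *)
Lemma reduces_mass_meet (e : code) (Z A A' C C' : mass_problem) :
  reduces e (mass_meet A A') Z -> reduces e (mass_meet C C') Z ->
  reduces e (mass_meet A C') Z.
Proof.
move=> eA eC f Zf; have [h Ah eh] := eA f Zf; have [k Ck ek] := eC f Zf.
have eq_kh : k = h by apply/funext => n; apply: eval_fun (ek n) (eh n).
rewrite {}eq_kh {ek k} in Ck; exists h => //.
case: Ah => [Ah|[g _ h1]]; first by left.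
(* Tags 1 and 0 on the same output would disagree at argument 0. *)
by case: Ck => [[g' _ h0]|Ch]; [rewrite h0 in h1; move/(congr1 (@^~ 0)): h1|right].
Qed.

Theorem theorem5p4 (d : Order.disp_t) (B : ctbDistrLatticeType d) :
  (exists phi : B -> medvedev,
    [/\ injective phi,
        {morph phi : x y / (x `&` y)%O >-> (x `&` y)%O}
      & {morph phi : x y / (x `|` y)%O >-> (x `|` y)%O}]) ->
  countable [set: B].
Proof.
move=> [phi [phi_inj phiI _]].
pose A b := medvedev_repr (phi b); pose Z := A \bot%O.
have phi_meet b c : medvedev_deg (mass_meet (A b) (A c)) = phi (b `&` c)%O.
  by rewrite medvedev_deg_meet !medvedev_reprK phiI.
have meet_le_bot b c : medvedev_le (mass_meet (A b) (A c)) Z <->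
    (b `&` c)%O = \bot%O.
  rewrite -[medvedev_le _ _]asboolE -medvedev_degE phi_meet medvedev_reprK.
  split=> [le0|->//]; apply: phi_inj; apply: le_anti; rewrite le0 /=.
  (* [Z] need not have the least Medvedev degree; its degree is below [phi (b]&[c)] because [phi]
     preserves meets. *)
  by rewrite leEmeet -phiI meet0x.
have [e eP] : {e : B -> code &
    forall b, reduces (e b) (mass_meet (A b) (A (~` b)%O)) Z}.
  apply: (@choice _ _ (fun b e => reduces e (mass_meet (A b) (A (~` b)%O)) Z)).
  by move=> b; apply/medvedev_leP/meet_le_bot; rewrite meetxC.
have e_le b c : e b = e c -> (b <= c)%O.
  (* [b <= c] becomes disjointness of [b] from the complement of [c]. *)
  move=> ebc; rewrite -[c]complK -disj_leC; apply/eqP/meet_le_bot/medvedev_leP.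
  exists (e b); apply: reduces_mass_meet (eP b) _; rewrite ebc; exact: eP.
apply/countable_injP; exists (fun b => pickle (tree_of_code (e b))).
move=> b c _ _ /(pcan_inj pickleK)/(can_inj tree_of_codeK) ebc.
by apply: le_anti; rewrite !e_le.
Qed.
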